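(* Let $\tau>0$ and $k>0$. Assume the distributions of a positive random variable $h$ under the null and alternative hypotheses are described by $$H_0:\ h\sim H(k,0),\qquad\qquad H_1:\ h\mid\lambda\sim H(k,\lambda),\quad \lambda\mid\tau^2\sim G\left(\frac{k}{2}+1,\frac{1}{2\tau^2}\right).$$ Then, for every $h>0$, the Bayes factor in favor of the alternative hypothesis is $$BF_{10}(h\mid\tau^2)=(\tau^2+1)^{-k/2-1}\left(1+\frac{\tau^2}{k(\tau^2+1)}h\right)\exp\left(\frac{\tau^2h}{2(\tau^2+1)}\right).$$
   Context: $H(k,\lambda)$ denotes the (non-central) $\chi^2$ distribution with $k$ degrees of freedom and non-centrality parameter $\lambda\ge 0$, with density on $h>0$ $$\sum_{i=0}^\infty\frac{e^{-\lambda/2}(\lambda/2)^i}{i!}\,\frac{h^{\frac{k}{2}+i-1}e^{-h/2}}{2^{\frac{k}{2}+i}\,\Gamma\left(\frac{k}{2}+i\right)}$$ (with $0^0=1$, so $H(k,0)$ is the central $\chi^2_k$ distribution). $G(\alpha,\beta)$ denotes the gamma distribution with shape parameter $\alpha$ and rate parameter $\beta$, with density $\frac{\beta^\alpha}{\Gamma(\alpha)}x^{\alpha-1}e^{-\beta x}$ on $x>0$. The hyperparameter $\tau^2$ is a fixed constant. The Bayes factor in favor of the alternative hypothesis based on a test statistic $x$ is $BF_{10}(x\mid\tau^2)=m_1(x\mid\tau^2)/m_0(x)$, where $m_0(x)$ is the density of the statistic under $H_0$, and $m_1(x\mid\tau^2)=\int f(x\mid\lambda)\,\pi(\lambda\mid\tau^2)\,d\lambda$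 is its marginal density under $H_1$. Here $f(x\mid\lambda)$ is the density of the statistic given $\lambda$ under $H_1$ and $\pi(\lambda\mid\tau^2)$ is the prior density of $\lambda$ under $H_1$. *)

(* Defs.v *)
From mathcomp Require Export all_boot all_order all_algebra.
From mathcomp Require Export all_classical all_reals all_analysis.
Export Order.TTheory GRing.Theory Num.Theory.
Export numFieldNormedType.Exports.

Set Implicit Arguments.
Unset Strict Implicit.
Unset Printing Implicit Defensive.

Local Open Scope classical_set_scope.
Local Open Scope ring_scope.

(* Euler's integral; it converges, so that the real-valued integral is not
   a default value, for a > 0. *)
Definition Gamma (R : realType) (a : R) : R :=
  \int[@lebesgue_measure R]_(x in `]0, +oo[) (x `^ (a - 1) * expR (- x)).

(* i-th term of the series defining the density of H(k, lambda) at h.  The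
   Poisson weight uses the natural power _ ^+ i, for which 0 ^+ 0 = 1. *)
Definition noncentral_chi2_term (R : realType) (k lambda h : R) (i : nat) : R :=
  expR (- (lambda / 2)) * (lambda / 2) ^+ i / i`!%:R *
  (h `^ (k / 2 + i%:R - 1) * expR (- (h / 2)) /
   (2 `^ (k / 2 + i%:R) * Gamma (k / 2 + i%:R))).

(* The series has nonnegative terms when k > 0 and 0 <= lambda, the range of
   parameters for which H(k, lambda) is defined; summing it in \bar R avoids
   a default value for the sum. *)
Definition noncentral_chi2_pdf (R : realType) (k lambda h : R) : \bar R :=
  if h <= 0 then 0%:E
  else (\sum_(0 <= i <oo) (noncentral_chi2_term k lambda h i)%:E)%E.

(* beta is the rate, not the scale. *)
Definition gamma_pdf (R : realType) (alpha beta x : R) : R :=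
  if x <= 0 then 0
  else beta `^ alpha / Gamma alpha * x `^ (alpha - 1) * expR (- (beta * x)).

(* f lambda x is the density of the statistic at x given the parameter lambda,
   and prior lambda is the prior density. *)
Definition marginal_pdf (R : realType) (f : R -> R -> \bar R) (prior : R -> R)
    (x : R) : \bar R :=
  (\int[@lebesgue_measure R]_lambda (f lambda x * (prior lambda)%:E))%E.

Definition bayes_factor (R : realType) (m1 m0 : R -> \bar R) (x : R) : \bar R :=
  (m1 x / m0 x)%E.

(* Main.v *)
(** The prior integrates the noncentral chi-squared series term by term (all
    terms are nonnegative), each term giving a Gamma integral, so that the
    [i]-th term of [m1 / m0] is, with [a = k / 2] and
    [z = tau^2 h / (2 (tau^2 + 1))],
    [(tau^2 + 1)^(- a - 1) * (Gamma (a + i + 1) / Gamma (a + i)) / a * z^i / i!].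
    The Gamma quotient is [a + i], so the series sums to [(1 + z / a) * e^z]. *)
Require Import Defs.
From mathcomp Require Import ring lra measurable_realfun.

Set Implicit Arguments.
Unset Strict Implicit.
Unset Printing Implicit Defensive.

Local Open Scope classical_set_scope.
Local Open Scope ring_scope.

(** * Positivity and finiteness of Euler's integral *)

Lemma measurable_powR_expR (R : realType) (b c : R) :
  measurable_fun [set: R] (fun x : R => x `^ b * expR (- (c * x))).
Proof.
apply: measurable_funM; first exact: measurable_powR.
apply: measurableT_comp; first exact: measurable_expR.
apply: measurable_funN; exact: measurable_funM.
Qed.

(** Raise [y <= expR y] at [y = x / (2 * b)] to the power [b]. Only half of the exponential decay is
    spent, so [expR (- (x / 2))] remains as an integrable majorant. *)
Lemma powR_le_expR (R : realType) (b x : R) : 0 < b -> 0 < x ->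
  x `^ b <= (2 * b) `^ b * expR (x / 2).
Proof.
move=> b0 x0; have b20 : 0 < 2 * b by rewrite mulr_gt0.
have xle : x <= 2 * b * expR (x / (2 * b)).
  rewrite mulrC -ler_pdivrMr//; apply: le_trans (expR_ge1Dx _).
  by rewrite lerDr.
rewrite (_ : x / 2 = x / (2 * b) * b); last by field; rewrite gt_eqF.
rewrite expRM -powRM ?expR_ge0 ?(ltW b20)//.
by apply: ge0_ler_powR => //; rewrite ?nnegrE ?mulr_ge0 ?expR_ge0 ?ltW.
Qed.

(** The integrand is twice the exponential density of rate 1/2, whose total mass is 1. *)
Lemma integral_expR_half_lty (R : realType) :
  (\int[@lebesgue_measure R]_(x in `]0%R, +oo[) (expR (- (2^-1 * x)))%:E < +oo)%E.
Proof.
have h0 : 0 < 2^-1 :> R by [].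
have m1 : measurable_fun [set: R] (fun x : R => expR (- (2^-1 * x))).
  by have := measurable_powR_expR (0 : R) 2^-1; under eq_fun do rewrite powRr0 mul1r.
apply: (@le_lt_trans _ _
  (\int[@lebesgue_measure R]_(x in `]0%R, +oo[) (2 * exponential_pdf 2^-1 x)%:E)%E).
  apply: ge0_le_integral => //=.
  - apply/measurable_EFinP; exact: measurable_funTS.
  - apply/measurable_EFinP; apply: measurable_funM => //.
    by apply: measurable_funTS; exact: measurable_exponential_pdf.
  - move=> x; rewrite in_itv/= andbT => x0.
    by rewrite lee_fin (exponential_pdfE _ (ltW x0)) mulNr mulrA divff// mul1r.
under eq_integral do rewrite EFinM.
have mE : measurable_fun [set: R] (EFin \o exponential_pdf 2^-1).
  by apply/measurable_EFinP; exact: measurable_exponential_pdf.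
rewrite ge0_integralZl_EFin//=; last 2 first.
- by move=> x _; rewrite lee_fin exponential_pdf_ge0.
- exact: measurable_funTS.
rewrite lte_mul_pinfty//.
apply: (@le_lt_trans _ _ 1%E); last by rewrite ltry.
rewrite -(integral_exponential_pdf h0).
by apply: ge0_subset_integral => //= x _; rewrite lee_fin exponential_pdf_ge0.
Qed.

Lemma Gamma_integral_gt0_lty (R : realType) (a : R) : 0 < a ->
  (0 < \int[@lebesgue_measure R]_(x in `]0%R, +oo[) (x `^ a * expR (- x))%:E
   < +oo)%E.
Proof.
move=> a0.
have mf : measurable_fun [set: R] (fun x : R => (x `^ a * expR (- x))%:E).
  apply/measurable_EFinP; have := measurable_powR_expR a 1.
  by under eq_fun do rewrite mul1r.
have f0 (x : R) : 0 <= x `^ a * expR (- x) by rewrite mulr_ge0 ?powR_ge0 ?expR_ge0.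
apply/andP; split.
  apply: (@lt_le_trans _ _
    (\int[@lebesgue_measure R]_(x in `[1%R, 2%R]) (expR (- 2))%:E)%E).
    rewrite integral_cst//= lebesgue_measure_itv/= lte_fin ltr1n.
    by rewrite -EFinD -EFinM lte_fin mulr_gt0 ?expR_gt0//; lra.
  apply: (@le_trans _ _
    (\int[@lebesgue_measure R]_(x in `[1%R, 2%R]) (x `^ a * expR (- x))%:E)%E).
    apply: ge0_le_integral => //=.
    - exact: measurable_funTS.
    - move=> x; rewrite in_itv/= => /andP[x1 x2]; rewrite lee_fin.
      rewrite -[leLHS]mul1r ler_pM ?expR_ge0 ?ler_expR ?lerN2//.
      by rewrite -(powRr0 x) ler_powR// ltW.
  apply: ge0_subset_integral => //=.
  - exact: measurable_funTS.
  - by move=> x _; rewrite lee_fin.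
  - by apply: subset_itv; rewrite bnd_simp.
apply: (@le_lt_trans _ _ (\int[@lebesgue_measure R]_(x in `]0%R, +oo[)
    (((2 * a) `^ a)%:E * (expR (- (2^-1 * x)))%:E))%E); last first.
  have := measurable_powR_expR (0 : R) 2^-1; under eq_fun do rewrite powRr0 mul1r.
  move=> /measurable_EFinP m1.
  rewrite ge0_integralZl_EFin ?powR_ge0//=; last exact: measurable_funTS.
  by rewrite lte_mul_pinfty ?lee_fin ?powR_ge0// integral_expR_half_lty.
apply: ge0_le_integral => //=.
- by move=> x _; rewrite lee_fin.
- exact: measurable_funTS.
- have := measurable_powR_expR (0 : R) 2^-1; under eq_fun do rewrite powRr0 mul1r.
  move=> m1; apply/measurable_EFinP; apply: measurable_funM => //.
  exact: measurable_funTS.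
- move=> x; rewrite in_itv/= andbT => x0; rewrite lee_fin.
  rewrite (_ : - (2^-1 * x) = x / 2 + - x); last by lra.
  rewrite expRD mulrA ler_wpM2r ?expR_ge0//.
  exact: powR_le_expR.
Qed.

(** * The functional equation of Gamma *)

Lemma bigcup_itv_inv (R : realType) :
  \bigcup_n `[(n.+2%:R : R)^-1, n.+2%:R]%classic = `]0, +oo[%classic.
Proof.
apply/seteqP; split => [x [n _]|x]/=; rewrite !in_itv/= ?andbT.
  by move=> /andP[+ _]; apply: lt_le_trans; rewrite invr_gt0.
(* The sum [x + x^-1] dominates both [x] and [x^-1], so one truncation serves both endpoints. *)
move=> x0; exists (Num.trunc (x + x^-1)) => //=.
rewrite in_itv/=.
have xV0 : 0 < x^-1 by rewrite invr_gt0.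
have /andP[_] := truncn_itv (ltW (addr_gt0 x0 xV0)); set n := Num.trunc _ => xn.
have xn2 : x + x^-1 < n.+2%:R.
  by apply: lt_trans xn _; rewrite ltr_nat.
apply/andP; split; last lra.
by rewrite invf_ple ?posrE//; lra.
Qed.

(** These are the boundary terms of the integration by parts: exponential decay kills the upper one,
    and [a > 0] the lower one. *)
Lemma cvg_powR_expR_boundary (R : realType) (a : R) : 0 < a ->
  n.+2%:R `^ a * - expR (- n.+2%:R) -
  n.+2%:R^-1 `^ a * - expR (- n.+2%:R^-1) @[n --> \oo] --> (0 : R).
Proof.
move=> a0; rewrite -[X in _ --> X](subrr 0).
have cvgV : (n.+2%:R^-1 : R) @[n --> \oo] --> (0 : R).
  by have := @cvg_harmonic R; rewrite -cvg_shiftS.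
apply: cvgB.
- rewrite -oppr0; under eq_fun do rewrite mulrN; apply: cvgN.
  apply: (@squeeze_cvgr _ _ _ _ (fun=> 0)
      (fun n => (2 * a) `^ a * 2 * n.+2%:R^-1)).
  + apply: nearW => n; rewrite mulr_ge0 ?powR_ge0 ?expR_ge0//=.
    have n0 : 0 < n.+2%:R :> R by [].
    apply: (@le_trans _ _ ((2 * a) `^ a * (expR (n.+2%:R / 2) * expR (- n.+2%:R)))).
      by rewrite mulrA ler_wpM2r ?expR_ge0// powR_le_expR.
    rewrite -mulrA ler_wpM2l ?powR_ge0// -expRD.
    rewrite (_ : _ + - _ = - (n.+2%:R / 2)); last lra.
    rewrite expRN -[leRHS]invrK lef_pV2 ?posrE ?invr_gt0 ?expR_gt0//.
    rewrite invfM invrK mulrC; apply: le_trans (expR_ge1Dx _); lra.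
  + exact: cvg_cst.
  + by rewrite -[X in _ --> X](mulr0 ((2 * a) `^ a * 2)); apply: cvgMr.
- rewrite -oppr0; under eq_fun do rewrite mulrN; apply: cvgN.
  apply: (@squeeze_cvgr _ _ _ _ (fun=> 0) (fun n => n.+2%:R^-1 `^ a)).
  + apply: nearW => n; rewrite mulr_ge0 ?powR_ge0 ?expR_ge0//=.
    by rewrite ler_piMr ?powR_ge0// expR_le1 oppr_le0 invr_ge0.
  + exact: cvg_cst.
  + by have /cvg_at_rightP := powR_cvg0 a0; apply; split => [n|//]; rewrite invr_gt0.
Qed.

Lemma integral_powR_expR_parts (R : realType) (a b c : R) :
  0 <= a -> 0 < b -> b < c ->
  (\int[@lebesgue_measure R]_(x in `[b, c]) (x `^ a * expR (- x))%:E =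
   (c `^ a * - expR (- c) - b `^ a * - expR (- b))%:E +
   a%:E * \int[@lebesgue_measure R]_(x in `[b, c])
            (x `^ (a - 1) * expR (- x))%:E)%E.
Proof.
move=> a0 b0 bc.
have gt0 x : x \in `[b, c]%R -> 0 < x.
  by rewrite in_itv/= => /andP[+ _]; exact: lt_le_trans.
have gt0W x : x \in `]b, c[%R -> 0 < x.
  by rewrite in_itv/= => /andP[+ _]; exact: lt_trans.
have dpow (r x : R) : 0 < x -> derivable (@powR R ^~ r) x 1.
  by move=> x0; have ? := is_derive1_powR r x0; exact: ex_derive.
have dexp (x : R) : is_derive x 1 (fun y => - expR (- y)) (expR (- x)).
  by apply: is_derive_eq; rewrite /GRing.scale/= ?mulr1 ?mulrN1 ?mul1r ?opprK.
have cpow (r x : R) : 0 < x -> {for x, continuous (@powR R ^~ r)}.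
  by move=> x0; apply/differentiable_continuous/derivable1_diffP/dpow.
have cexp : continuous (fun y : R => - expR (- y)).
  by move=> x; apply/differentiable_continuous/derivable1_diffP/ex_derive.
rewrite (@integration_by_parts _ (@powR R ^~ a) (fun x => - expR (- x))
  (fun x => a * x `^ (a - 1)) (fun x => expR (- x)))//=.
- congr (_ + _)%E.
  (* The antiderivative [- expR (- x)] makes the subtracted integrand nonpositive; the two signs
     cancel. *)
  under eq_integral do rewrite mulrN EFinN -mulrA EFinM.
  have f0 (x : R) : (0 <= (x `^ (a - 1) * expR (- x))%:E)%E.
    by rewrite lee_fin mulr_ge0 ?powR_ge0 ?expR_ge0.
  rewrite integral_ge0N ?oppeK; last first.
    by move=> x _; rewrite mule_ge0.
  rewrite ge0_integralZl_EFin//.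
  apply: measurable_funTS; apply/measurable_EFinP.
  by have := measurable_powR_expR (a - 1) 1; under eq_fun do rewrite mul1r.
- apply: derivable_within_continuous => x /gt0 x0.
  by apply: derivableM => //; exact: dpow.
- split.
  + by move=> x /gt0W; exact: dpow.
  + exact/cvg_at_right_filter/cpow.
  + by apply/cvg_at_left_filter/cpow/(lt_trans b0).
- by move=> x /gt0W x0; rewrite powR_derive1// in_itv/= andbT.
- apply: derivable_within_continuous => x _; exact: ex_derive.
- split.
  + by move=> x _; exact: ex_derive.
  + exact/cvg_at_right_filter/cexp.
  + exact/cvg_at_left_filter/cexp.
- by move=> x _; rewrite derive1E derive_val.
Qed.

(* Integration by parts on [1/(n+2), n+2] with monotone limits needs no
   integrability: as an identity in \bar R it transfers finiteness from the
   exponent [a > 0] to [a - 1], where the integrand may be unbounded at 0. *)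
Lemma Gamma_integralS (R : realType) (a : R) : 0 < a ->
  (\int[@lebesgue_measure R]_(x in `]0%R, +oo[) (x `^ a * expR (- x))%:E =
   a%:E * \int[@lebesgue_measure R]_(x in `]0%R, +oo[)
            (x `^ (a - 1) * expR (- x))%:E)%E.
Proof.
move=> a0.
pose I n := `[(n.+2%:R : R)^-1, n.+2%:R]%classic.
(* Monotone convergence along the growing intervals, for every real exponent and with an infinite
   limit allowed. *)
have I_cvg b : (\int[@lebesgue_measure R]_(x in I n) (x `^ b * expR (- x))%:E)%E
    @[n --> \oo] -->
    (\int[@lebesgue_measure R]_(x in `]0%R, +oo[) (x `^ b * expR (- x))%:E)%E.
  rewrite -bigcup_itv_inv; apply: ge0_nondecreasing_set_cvg_integral.
  - move=> m n mn; apply/subsetPset/subset_itv; rewrite bnd_simp ?ler_nat//.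
    by rewrite lef_pV2 ?posrE// ler_nat.
  - by move=> n; exact: measurable_itv.
  - move=> n; apply: measurable_funTS; apply/measurable_EFinP.
    by have := measurable_powR_expR b 1; under eq_fun do rewrite mul1r.
  - by move=> n x _; rewrite lee_fin mulr_ge0 ?powR_ge0 ?expR_ge0.
apply: (cvg_unique _ (I_cvg a)) => //=.
have I_parts n : (\int[@lebesgue_measure R]_(x in I n) (x `^ a * expR (- x))%:E =
    (n.+2%:R `^ a * - expR (- n.+2%:R) -
     n.+2%:R^-1 `^ a * - expR (- n.+2%:R^-1))%:E +
    a%:E * \int[@lebesgue_measure R]_(x in I n) (x `^ (a - 1) * expR (- x))%:E)%E.
  apply: (integral_powR_expR_parts (ltW a0)).
    by rewrite invr_gt0.
  by rewrite (@lt_trans _ _ 1)// ?ltr1n// invf_lt1 ?ltr1n.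
under eq_fun do rewrite I_parts.
have bdry : ((n.+2%:R `^ a * - expR (- n.+2%:R) -
    n.+2%:R^-1 `^ a * - expR (- n.+2%:R^-1))%:E @[n --> \oo] --> 0%:E)%E.
  by apply: cvg_EFin; [exact: nearW | exact: cvg_powR_expR_boundary].
(* The added 0 is the limit of the boundary terms; being finite, it makes the sum of limits well
   defined. *)
rewrite -[(a%:E * _)%E]add0e.
by apply: cvgeD => //; exact: cvgeZl.
Qed.

(** Multiplied by [a > 0], this integral is the one with exponent [a], which is positive and finite.
    Neither infinite value is then possible, so [Gamma a] is the true integral. *)
Lemma GammaE (R : realType) (a : R) : 0 < a ->
  (\int[@lebesgue_measure R]_(x in `]0%R, +oo[)
     (x `^ (a - 1) * expR (- x))%:E = (Gamma a)%:E)%E /\ 0 < Gamma a.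
Proof.
move=> a0; have := Gamma_integral_gt0_lty a0; rewrite Gamma_integralS//.
rewrite /Gamma /Rintegral.
case: (integral _ _ _) => [r| |]/=.
- by rewrite -EFinM lte_fin pmulr_rgt0// => /andP[].
- by rewrite gt0_muley ?lte_fin// ltxx andbF.
- by rewrite gt0_muleNy ?lte_fin// ltNge leNye.
Qed.

Lemma Gamma_gt0 (R : realType) (a : R) : 0 < a -> 0 < Gamma a.
Proof. by move=> /GammaE[]. Qed.

Lemma GammaS (R : realType) (a : R) : 0 < a -> Gamma (a + 1) = a * Gamma a.
Proof.
move=> a0; apply: EFin_inj; rewrite EFinM -(GammaE a0).1 -Gamma_integralS//.
by rewrite -(GammaE (addr_gt0 a0 ltr01)).1 addrK.
Qed.

Lemma integral_powR_expR (R : realType) (a c : R) : 0 < a -> 0 < c ->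
  (\int[@lebesgue_measure R]_(x in `]0%R, +oo[) (x `^ a * expR (- (c * x)))%:E
   = (Gamma (a + 1) / c `^ (a + 1))%:E)%E.
Proof.
move=> a0 c0.
have dlin (x : R) : is_derive x 1 ( *%R c) c.
  by apply: is_derive_eq; rewrite /GRing.scale/= ?mulr0 ?addr0 ?mulr1.
have lin' : ( *%R c)^`()%classic = cst c.
  by apply/funext => x; rewrite derive1E derive_val.
have mf : measurable_fun [set: R] (fun x : R => x `^ a * expR (- x)).
  by have := measurable_powR_expR a 1; under eq_fun do rewrite mul1r.
have ca : c `^ (a + 1) = c * c `^ a.
  by rewrite powRD ?powRr1 1?mulrC ?ltW// (gt_eqF c0) implybT.
have := (GammaE (addr_gt0 a0 ltr01)).1; rewrite addrK => GE.
have mG : measurable_fun [set: R]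
    (((fun y : R => y `^ a * expR (- y)) \o ( *%R c)) * cst c).
  by apply: measurable_funM => //; exact: measurableT_comp.
have subst : (\int[@lebesgue_measure R]_(x in `[(c * 0)%R, +oo[)
    (x `^ a * expR (- x))%:E =
    \int[@lebesgue_measure R]_(x in `[0%R, +oo[)
      ((((fun y => y `^ a * expR (- y)) \o ( *%R c)) * ( *%R c)^`()%classic) x)%:E)%E.
  apply: increasing_ge0_integration_by_substitutiony.
  - by move=> x y _ _ xy; rewrite ltr_pM2l.
  - by rewrite lin' => x _; exact: cvg_cst.
  - by rewrite lin'; exact: is_cvg_cst.
  - by rewrite lin'; exact: is_cvg_cst.
  - split; first by move=> x _; exact: ex_derive.
    exact/cvg_at_right_filter/differentiable_continuous/derivable1_diffP/ex_derive.
  - exact: gt0_cvgMry.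
  - rewrite mulr0; apply/continuous_within_itvcyP; split.
      move=> x; rewrite in_itv/= andbT => x0.
      apply/differentiable_continuous/derivable1_diffP/derivableM.
        by apply: derivable_powR; rewrite in_itv/= andbT.
      exact: ex_derive.
    (* At the endpoint 0, [a > 0] makes the power vanish and tend to 0 from the right. *)
    rewrite powR0 ?gt_eqF// mul0r.
    rewrite -[X in _ --> X](mul0r (expR (- 0))); apply: cvgM; first exact: powR_cvg0.
    have cexp : {for 0%R, continuous (fun y : R => expR (- y))}.
      by apply/differentiable_continuous/derivable1_diffP/ex_derive.
    exact: cvg_at_right_filter cexp.
  - by move=> x _; rewrite mulr_ge0 ?powR_ge0 ?expR_ge0.
rewrite mulr0 in subst.
(* The substitution is made on the closed half-line; the endpoint 0 is a null set and is dropped on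
   both sides. *)
rewrite -integral_itv_obnd_cbnd in subst; last first.
  by apply: measurable_funTS; apply/measurable_EFinP.
rewrite -integral_itv_obnd_cbnd in subst; last first.
  by rewrite lin'; apply: measurable_funTS; apply/measurable_EFinP.
rewrite GE lin' in subst.
rewrite mulrC EFinM subst -ge0_integralZl_EFin//; last 3 first.
- by move=> x _; rewrite lee_fin /= !mulr_ge0 ?powR_ge0 ?expR_ge0 ?ltW.
- by apply: measurable_funTS; apply/measurable_EFinP.
- by rewrite invr_ge0 powR_ge0.
apply: eq_integral => x; rewrite inE/= in_itv/= andbT => x0.
rewrite -EFinM; congr EFin.
rewrite -[RHS]/(_ * ((c * x) `^ a * expR (- (c * x)) * c)).
have c1 : c `^ a != 0 by rewrite gt_eqF// powR_gt0.
by rewrite powRM ?(ltW x0) ?(ltW c0)// ca; field; rewrite c1 gt_eqF.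
Qed.

(** * Summing the series and computing its terms *)

Lemma nneseries_EFin (R : realType) (u : R^nat) (l : R) :
  series u @ \oo --> l -> (\sum_(0 <= i <oo) (u i)%:E = l%:E)%E.
Proof.
move=> ul; under eq_fun do rewrite sumEFin.
rewrite (@EFin_lim _ (series u)); first by rewrite (cvg_lim _ ul).
by apply/cvg_ex; exists l.
Qed.

(** Split [(a + i) / a] as [1 + i / a]; since [i * z^i / i! = z * z^(i-1) / (i-1)!], the second part
    is [z / a] times the exponential series shifted by one, hence the [n.+1] and [n] in
    [seriesE]. *)
Lemma cvg_series_size_biased_exp (R : realType) (a z : R) : 0 < a ->
  series (fun i => (a + i%:R) / a * (z ^+ i / i`!%:R)) @ \oo -->
  (1 + z / a) * expR z.
Proof.
move=> a0; have a1 : a != 0 by rewrite gt_eqF.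
have seriesE n : series (fun i => (a + i%:R) / a * (z ^+ i / i`!%:R)) n.+1 =
    series (exp_coeff z) n.+1 + z / a * series (exp_coeff z) n.
  rewrite /series/=; elim: n => [|n IH].
    by rewrite !big_nat1 big_geq// /exp_coeff/= addr0 mulr0 addr0 divff// mul1r.
  rewrite big_nat_recr//= IH [in RHS]big_nat_recr//=.
  rewrite [X in _ = _ + _ * X]big_nat_recr//= /exp_coeff/= factS natrM exprS.
  have f0 : n`!%:R != 0 :> R by rewrite pnatr_eq0 -lt0n fact_gt0.
  have n0 : n.+1%:R != 0 :> R by [].
  by field; rewrite a1 f0 addrC natr1 n0.
rewrite -cvg_shiftS; under eq_fun do rewrite seriesE.
have cvg_exp : series (exp_coeff z) @ \oo --> expR z.
  exact: is_cvg_series_exp_coeff.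
rewrite mulrDl mul1r; apply: cvgD; first by rewrite cvg_shiftS.
exact: cvgMr.
Qed.

Lemma noncentral_chi2_pdf0 (R : realType) (k h : R) : 0 < h ->
  noncentral_chi2_pdf k 0 h =
  (h `^ (k / 2 - 1) * expR (- (h / 2)) / (2 `^ (k / 2) * Gamma (k / 2)))%:E.
Proof.
move=> h0; rewrite /noncentral_chi2_pdf leNgt h0/=; apply: nneseries_EFin.
(* Only the term [i = 0] survives, by [0 ^+ 0 = 1], so all partial sums but the empty one equal
   [l]. *)
rewrite -cvg_shiftS; set l := _ / (_ * Gamma _).
suff -> : (fun n => series (noncentral_chi2_term k 0 h) n.+1) = cst l.
  exact: cvg_cst.
apply/funext => n; rewrite /series/= big_nat_recl//= big1 => [|i _].
  rewrite /noncentral_chi2_term mul0r oppr0 expR0 expr0 fact0 invr1 !mul1r.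
  by rewrite !addr0.
by rewrite /noncentral_chi2_term mul0r exprS mul0r mulr0 !mul0r.
Qed.

(** The Poisson weight contributes [x^i] and rate 1/2, the prior [x^(k/2)] and rate [b]: together a
    gamma kernel of shape [k / 2 + i + 1] and rate [1/2 + b], split off from the factors free of
    [x]. *)
Lemma noncentral_chi2_gammaE (R : realType) (k b h x : R) (i : nat) : 0 < x ->
  noncentral_chi2_term k x h i * gamma_pdf (k / 2 + 1) b x =
  h `^ (k / 2 + i%:R - 1) * expR (- (h / 2)) /
    (2 `^ (k / 2 + i%:R) * Gamma (k / 2 + i%:R)) *
  (b `^ (k / 2 + 1) / Gamma (k / 2 + 1) / (2 ^+ i * i`!%:R)) *
  (x `^ (k / 2 + i%:R) * expR (- ((2^-1 + b) * x))).
Proof.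
move=> x0; rewrite /gamma_pdf leNgt x0/= addrK /noncentral_chi2_term.
rewrite (@powRD _ x); last by rewrite (gt_eqF x0) implybT.
rewrite powR_mulrn ?(ltW x0)// mulrDl opprD expRD expr_div_n (mulrC x) !invfM.
ring.
Qed.

Lemma chi2_gamma_term_ratio (R : realType) (s k h : R) (i : nat) :
  0 < s -> 0 < k -> 0 < h ->
  h `^ (k / 2 + i%:R - 1) * expR (- (h / 2)) /
    (2 `^ (k / 2 + i%:R) * Gamma (k / 2 + i%:R)) *
  ((1 / (2 * s)) `^ (k / 2 + 1) / Gamma (k / 2 + 1) / (2 ^+ i * i`!%:R)) *
  (Gamma (k / 2 + i%:R + 1) / (2^-1 + 1 / (2 * s)) `^ (k / 2 + i%:R + 1)) =
  h `^ (k / 2 - 1) * expR (- (h / 2)) / (2 `^ (k / 2) * Gamma (k / 2)) *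
  (s + 1) `^ (- (k / 2) - 1) *
  ((k / 2 + i%:R) / (k / 2) * ((s * h / (2 * (s + 1))) ^+ i / i`!%:R)).
Proof.
move=> s0 k0 h0; set a := k / 2.
have a0 : 0 < a by rewrite divr_gt0.
have ai0 : 0 < a + i%:R by rewrite ltr_wpDr.
have s10 : 0 < s + 1 by rewrite addr_gt0.
have -> : a + i%:R - 1 = a - 1 + i%:R by ring.
have -> : a + i%:R + 1 = a + 1 + i%:R by ring.
have -> : - a - 1 = - (a + 1) by ring.
have powRDn (x r : R) : 0 < x -> x `^ (r + i%:R) = x `^ r * x ^+ i.
  by move=> x0; rewrite powRD ?(gt_eqF x0) ?implybT// powR_mulrn// ltW.
have c0 : 0 < 2^-1 + 1 / (2 * s) by rewrite addr_gt0 ?divr_gt0 ?mulr_gt0 ?invr_gt0.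
rewrite !powRDn// powRN (addrAC a 1) GammaS// GammaS//.
have -> : 2^-1 + 1 / (2 * s) = (s + 1) * (1 / (2 * s)).
  by field; rewrite gt_eqF.
have d0 : 0 < 1 / (2 * s) by rewrite divr_gt0 ?mulr_gt0.
rewrite powRM ?ltW//.
(* One [2 ^+ i] comes from the chi-squared normalisation, the other from the Poisson weight. *)
have -> : (s * h / (2 * (s + 1))) ^+ i =
    h ^+ i / (2 ^+ i * 2 ^+ i * ((s + 1) * (1 / (2 * s))) ^+ i).
  rewrite -!exprMn -expr_div_n; congr (_ ^+ i).
  by field; rewrite !gt_eqF.
have nz (x : R) : 0 < x -> x != 0 by move=> x0; rewrite gt_eqF.
have := nz _ (exprn_gt0 i (mulr_gt0 s10 d0)); move: (((s + 1) * _) ^+ i) => q q0.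
have := nz _ (powR_gt0 (a + 1) d0); move: ((1 / (2 * s)) `^ (a + 1)) => p p0.
by field; rewrite q0 p0 !nz ?powR_gt0 ?Gamma_gt0 ?exprn_gt0 ?ltr0n ?fact_gt0.
Qed.

Theorem theorem3 (R : realType) (tau k : R) (tau_gt0 : 0 < tau) (k_gt0 : 0 < k)
    (h : R) (h_gt0 : 0 < h) :
  bayes_factor
    (marginal_pdf (noncentral_chi2_pdf k)
       (gamma_pdf (k / 2 + 1) (1 / (2 * tau ^+ 2))))
    (noncentral_chi2_pdf k 0) h =
  ((tau ^+ 2 + 1) `^ (- (k / 2) - 1) *
   (1 + tau ^+ 2 / (k * (tau ^+ 2 + 1)) * h) *
   expR (tau ^+ 2 * h / (2 * (tau ^+ 2 + 1))))%:E.
Proof.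
have : 0 < tau ^+ 2 by rewrite exprn_gt0.
(* [tau] enters only through its square. *)
move: (tau ^+ 2) => s s0.
have a0 : 0 < k / 2 by rewrite divr_gt0.
have ai0 i : 0 < k / 2 + i%:R by rewrite ltr_wpDr.
have b0 : 0 < 1 / (2 * s) by rewrite divr_gt0 ?mulr_gt0.
have c0 : 0 < 2^-1 + 1 / (2 * s) by rewrite addr_gt0 ?invr_gt0.
have s10 : 0 < s + 1 by rewrite addr_gt0.
set b := 1 / (2 * s) in b0 c0 *.
have Gamma_ge0 (x : R) : 0 < x -> 0 <= Gamma x by move=> /Gamma_gt0/ltW.
pose coef i := h `^ (k / 2 + i%:R - 1) * expR (- (h / 2)) /
    (2 `^ (k / 2 + i%:R) * Gamma (k / 2 + i%:R)) *
  (b `^ (k / 2 + 1) / Gamma (k / 2 + 1) / (2 ^+ i * i`!%:R)).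
have coef_ge0 i : 0 <= coef i.
  by rewrite /coef !mulr_ge0 ?invr_ge0 ?mulr_ge0 ?invr_ge0 ?powR_ge0 ?expR_ge0
    ?exprn_ge0 ?Gamma_ge0 // addr_gt0.
pose kern i x := x `^ (k / 2 + i%:R) * expR (- ((2^-1 + b) * x)).
have kern_ge0 i x : 0 <= kern i x by rewrite mulr_ge0 ?powR_ge0 ?expR_ge0.
have kern_meas i : measurable_fun [set: R] (EFin \o kern i).
  by apply/measurable_EFinP; exact: measurable_powR_expR.
have m1E : (marginal_pdf (noncentral_chi2_pdf k) (gamma_pdf (k / 2 + 1) b) h =
    \int[@lebesgue_measure R]_(x in `]0%R, +oo[)
      \sum_(0 <= i <oo) ((coef i)%:E * (kern i x)%:E))%E.
  (* The prior vanishes for [x <= 0], which restricts the integral to the open half-line. *)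
  rewrite /marginal_pdf [RHS]integral_mkcond; apply: eq_integral => x _.
  rewrite patchE; case: ifPn; rewrite ?notin_setE ?inE/= in_itv/= andbT => x0.
    rewrite /noncentral_chi2_pdf leNgt h_gt0/= muleC -nneseriesZl.
      apply: eq_eseriesr => i _.
      by rewrite -!EFinM mulrC noncentral_chi2_gammaE.
    move=> i _; rewrite lee_fin.
    by rewrite /noncentral_chi2_term !mulr_ge0 ?invr_ge0 ?mulr_ge0 ?powR_ge0
      ?expR_ge0 ?exprn_ge0 ?Gamma_ge0 ?mulr_ge0 ?(ltW x0).
  by rewrite /gamma_pdf leNgt (negbTE (introN idP x0))/= mule0.
pose z := s * h / (2 * (s + 1)).
pose m0 := h `^ (k / 2 - 1) * expR (- (h / 2)) / (2 `^ (k / 2) * Gamma (k / 2)).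
have m0_gt0 : 0 < m0.
  by rewrite divr_gt0 ?(mulr_gt0, powR_gt0, expR_gt0, Gamma_gt0).
have {}m1E : marginal_pdf (noncentral_chi2_pdf k) (gamma_pdf (k / 2 + 1) b) h =
    (m0 * (s + 1) `^ (- (k / 2) - 1) * ((1 + z / (k / 2)) * expR z))%:E.
  (* Tonelli: nonnegative measurable terms allow the exchange of sum and integral. *)
  rewrite m1E integral_nneseries//=; last 2 first.
  - by move=> i; apply: measurable_funeM; exact: measurable_funTS (kern_meas i).
  - by move=> i x _; rewrite -EFinM lee_fin mulr_ge0.
  rewrite EFinM -(nneseries_EFin (cvg_series_size_biased_exp a0)) -nneseriesZl.
    apply: eq_eseriesr => i _.
    rewrite ge0_integralZl_EFin//; last 2 first.
    - by move=> x _; rewrite lee_fin.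
    - exact: measurable_funTS (kern_meas i).
    by rewrite integral_powR_expR// -!EFinM chi2_gamma_term_ratio.
  move=> i _; rewrite lee_fin mulr_ge0 ?divr_ge0 ?exprn_ge0 ?ltW//.
  by rewrite divr_gt0 ?mulr_gt0.
(* As [m0] is nonzero, the quotient in [\bar R] is that of real numbers. *)
rewrite /bayes_factor m1E noncentral_chi2_pdf0// inver gt_eqF//.
rewrite -/m0 -EFinM; congr EFin; rewrite /z.
by field; rewrite !gt_eqF.
Qed.
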